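(* Let $k\geq 3$ and $n\geq 1$ be integers. All $(k,n)$-accordions have the same number of spanning trees; denote this common number by $\tau(A(k,n))$. Moreover, for all integers $k\geq 3$ and $n\geq 3$, \[ \tau(A(k,n))=k\cdot \tau(A(k,n-1))-\tau(A(k,n-2)). \]
   Context: For integers $k\geq 3$, $n\geq 1$, a $(k,n)$-accordion is any graph $A_n$ obtained as follows. (i) Let $A_1$ be a $k$-cycle $C^k_1$, embedded in the plane, and designate all its edges as free. (ii) For $i=2,\ldots,n$: choose a free edge $(r,s)$ of $A_{i-1}$ and add a new $k$-cycle $C^k_i$ that consists of the edge $(r,s)$ together with a path of $k-1$ edges through $k-2$ new nodes from $r$ to $s$, such that the resulting graph $A_i$ is planar embedded; designate as free exactly the edges incident to a new node of this step. The number of spanning trees of a graph $G$ is denoted $\tau(G)$. *)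

(* Defs.v *)
From HB Require Import structures.
From mathcomp Require Import all_boot all_order all_algebra.

Set Implicit Arguments.
Unset Strict Implicit.
Unset Printing Implicit Defensive.

(* A finite simple graph whose vertices are taken from an ambient finite type;
   the vertex set may be a proper subset of T, so that a graph and the larger
   graphs built from it by adding new vertices share the same type. *)
Record sgraph (T : finType) := SGraph {
  vertices : {set T};
  edges : {set {set T}};
  edgesP : forall e, e \in edges -> e \subset vertices /\ #|e| = 2 }.

Definition adj (T : finType) (F : {set {set T}}) : rel T :=
  fun x y => [set x; y] \in F.

Definition connected (T : finType) (V : {set T}) (F : {set {set T}}) : bool :=
  [forall x in V, forall y in V, connect (adj F) x y].

(* The vertices of a cycle are pairwise distinct, so its length is at most
   #|T|; the bound only serves to make the quantification finite. *)
Definition acyclic (T : finType) (F : {set {set T}}) : bool :=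
  [forall m : 'I_#|T|.+1, forall c : m.-tuple T,
     ~~ [&& 2 < m, uniq c & cycle (adj F) c]].

Lemma acyclicP (T : finType) (F : {set {set T}}) :
  reflect (forall c : seq T, 2 < size c -> uniq c -> ~~ cycle (adj F) c)
          (acyclic F).
Proof.
apply: (iffP forallP) => [acF c c_gt2 Uc | acF m].
  have lt_c : size c < #|T|.+1 by rewrite ltnS -(card_uniqP Uc) max_card.
  have /forallP/(_ (in_tuple c)) := acF (Ordinal lt_c).
  by rewrite /= c_gt2 Uc.
apply/forallP=> c; apply/negP=> /and3P[m_gt2 Uc].
by apply/negP/acF; rewrite ?size_tuple.
Qed.

Definition tree (T : finType) (V : {set T}) (F : {set {set T}}) : bool :=
  connected V F && acyclic F.

Definition tau (T : finType) (G : sgraph T) : nat :=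
  #|[set F : {set {set T}} | (F \subset edges G) && tree (vertices G) F]|.

(* The edges joining consecutive vertices of the walk x :: p. *)
Definition walk_edges (T : finType) (x : T) (p : seq T) : {set {set T}} :=
  [set [set d.1; d.2] | d in zip (x :: p) p].

(* accordion_free k n G fr: G is a (k, n)-accordion in which fr is the set of
   edges that are currently free.
   The planar embedding that accompanies the construction is not recorded: it
   does not restrict which graphs arise, because in any planar embedding of G
   the new path can be drawn alongside the edge {r, s}, inside a face incident
   to that edge. *)
Inductive accordion_free (T : finType) (k : nat) :
    nat -> sgraph T -> {set {set T}} -> Prop :=
| AccordionCycle (G : sgraph T) (x : T) (p : seq T) :
    uniq (x :: p) -> size (x :: p) = k ->
    vertices G = [set y in x :: p] ->
    edges G = walk_edges x (rcons p x) ->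
    accordion_free k 1 G (edges G)
| AccordionStep (n : nat) (G G' : sgraph T) (fr : {set {set T}})
    (r s : T) (p : seq T) :
    accordion_free k n G fr ->
    [set r; s] \in fr ->
    uniq p -> size p = k - 2 -> [disjoint p & vertices G] ->
    vertices G' = vertices G :|: [set y in p] ->
    edges G' = edges G :|: walk_edges r (rcons p s) ->
    accordion_free k n.+1 G' [set e in edges G' | [exists y in e, y \in p]].

Definition accordion (T : finType) (k n : nat) (G : sgraph T) : Prop :=
  exists fr : {set {set T}}, accordion_free k n G fr.

(* Main.v *)
Require Import Defs.
From HB Require Import structures.
From mathcomp Require Import all_boot all_order all_algebra.

Set Implicit Arguments.
Unset Strict Implicit.
Unset Printing Implicit Defensive.

(** Let [t] be the number of spanning trees of a graph and [c] the number of
    those through a given edge [rs], that is, of spanning forests with two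
    components that separate [r] from [s]. Growing a path from [r] one pendant
    vertex at a time keeps [t] and adds [t] to [c]; closing the path at [s]
    adds [c] to [t]. Hence an ear with [k - 1] edges on [rs] gives
    [(k - 1) t + c] spanning trees. Deleting any edge of the ear leaves pendant
    paths, so exactly [t] of these trees avoid it; the number of trees avoiding
    a free edge is thus the number of spanning trees of the previous accordion,
    and [t' = k t - t_previous]. The initial cycle is an ear with [r = s] on a
    single vertex. *)

Definition subset_count (U : finType) (E : {set U}) (P : pred {set U}) : nat :=
  #|[set F : {set U} | (F \subset E) && P F]|.

Lemma eq_subset_count (U : finType) (E : {set U}) (P Q : pred {set U}) :
  (forall F : {set U}, F \subset E -> P F = Q F) ->
  subset_count E P = subset_count E Q.
Proof.
by move=> eqPQ; apply: eq_card => F; rewrite !inE; apply: andb_id2l => /eqPQ.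
Qed.

Lemma subset_count0 (U : finType) (E : {set U}) (P : pred {set U}) :
  (forall F : {set U}, F \subset E -> ~~ P F) -> subset_count E P = 0.
Proof.
move=> P0; apply: eq_card0 => F; rewrite !inE.
by apply/negP=> /andP[/P0/negP].
Qed.

Lemma subset_count_setU1 (U : finType) (e : U) (E : {set U})
    (P : pred {set U}) :
  e \notin E ->
  subset_count (e |: E) P
  = subset_count E P + subset_count E (fun F => P (e |: F)).
Proof.
move=> eE; rewrite {1}/subset_count -(cardsID [set F : {set U} | e \notin F]).
congr (_ + _).
  by apply: eq_card => F; rewrite !inE andbAC -subsetD1 setU1K.
rewrite /subset_count -[RHS](card_in_imset (f := setU [set e])); last first.
  move=> F1 F2; rewrite !inE => /andP[sF1 _] /andP[sF2 _] eqF.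
  have fresh (F : {set U}) : F \subset E -> e \notin F.
    by move=> sF; apply: contra eE; apply: (subsetP sF).
  by rewrite -(setU1K (fresh _ sF1)) eqF setU1K ?fresh.
apply: eq_card => F; rewrite !inE negbK.
apply/idP/imsetP=> [/and3P[eF sF PF]|[F0]].
  by exists (F :\ e); rewrite ?inE setD1K // PF andbT subDset.
by rewrite !inE => /andP[sF PF] ->; rewrite PF setU11 setUS.
Qed.

Lemma uniq_disjoint_cons (T : finType) (A : {set T}) (z : T) (p : seq T) :
  uniq (z :: p) -> [disjoint z :: p & A] ->
  [/\ z \notin A, uniq p & [disjoint p & z |: A]].
Proof.
rewrite disjoint_cons => /andP[zp Up] /andP[zA dA]; split=> //.
rewrite disjoint_has; apply/hasPn=> y yp.
by rewrite in_setU1 (disjointFr dA yp) orbF; apply: contraNneq zp => <-.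
Qed.

Lemma last_notin_disjoint (T : finType) (A : {set T}) (r : T) (p : seq T) :
  0 < size p -> [disjoint p & A] -> last r p \notin A.
Proof. by case: p => // z p _ dA; rewrite (disjointFr dA (mem_last _ _)). Qed.

Lemma exists_uniq_disjoint (T : finType) (A : {set T}) (m : nat) :
  m + #|A| <= #|T| ->
  exists p : seq T, [/\ uniq p, size p = m & [disjoint p & A]].
Proof.
move=> leT; exists (take m (enum (~: A))); split.
- by rewrite take_uniq ?enum_uniq.
- by rewrite size_takel // -cardE cardsCs setCK leq_subRL ?max_card // addnC.
by rewrite disjoint_has; apply/hasPn=> y /mem_take; rewrite mem_enum inE.
Qed.

Section Forests.

Variable T : finType.
Implicit Types (x y z r s u v : T) (V : {set T}) (E F : {set {set T}}).

Lemma adj_sym F : symmetric (adj F).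
Proof. by move=> x y; rewrite /adj setUC. Qed.

Lemma connect_adj_sym F : connect_sym (adj F).
Proof. exact/sym_connect_sym/adj_sym. Qed.

Lemma sub_adj F F' : F \subset F' -> subrel (adj F) (adj F').
Proof. by move=> sF x y; apply: (subsetP sF). Qed.

Lemma sub_connect_adj F F' :
  F \subset F' -> subrel (connect (adj F)) (connect (adj F')).
Proof. by move/sub_adj=> sF; apply: connect_sub => x y /sF/connect1. Qed.

Lemma adj_setU1 e F x y : adj (e |: F) x y = ([set x; y] == e) || adj F x y.
Proof. exact: in_setU1. Qed.

Lemma adj_setD1 e F x y : adj (F :\ e) x y = ([set x; y] != e) && adj F x y.
Proof. exact: in_setD1. Qed.

Lemma eq_set2 x y u v : [set x; y] = [set u; v] ->
  (x = u /\ y = v) \/ (x = v /\ y = u).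
Proof.
move=> eqs.
have /set2P[xE|xE] : x \in [set u; v] by rewrite -eqs set21.
  left; split=> //.
  have /set2P[yE|//] : y \in [set u; v] by rewrite -eqs set22.
  have /set2P[->|-> //] : v \in [set x; y] by rewrite eqs set22.
  by rewrite xE yE.
right; split=> //.
have /set2P[//|yE] : y \in [set u; v] by rewrite -eqs set22.
have /set2P[->|-> //] : u \in [set x; y] by rewrite eqs set21.
by rewrite xE yE.
Qed.

Lemma connect_setU1 x y F u v :
  connect (adj ([set x; y] |: F)) u v =
  [|| connect (adj F) u v,
      connect (adj F) u x && connect (adj F) y v
    | connect (adj F) u y && connect (adj F) x v].
Proof.
have symF := connect_adj_sym F.
have sub := @sub_connect_adj _ _ (subsetUr [set [set x; y]] F).
have xy : connect (adj ([set x; y] |: F)) x y by apply/connect1/setU11.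
pose linked := [pred w | [|| connect (adj F) w v,
    connect (adj F) w x && connect (adj F) y v
  | connect (adj F) w y && connect (adj F) x v]].
rewrite -[RHS]/(linked u); apply/idP/idP=> [uv|].
- suff linked_closed : closed (adj ([set x; y] |: F)) linked.
    by have := closed_connect linked_closed uv; rewrite !inE connect0 => ->.
  apply: intro_closed => [|a b]; first exact: connect_adj_sym.
  rewrite adj_setU1 !inE => /orP[/eqP/eq_set2|ab].
    by case=> -[-> ->] /or3P[|/andP[_]|/andP[_]] ->; rewrite ?connect0 ?orbT.
  by rewrite !(same_connect1 symF ab).
- case/or3P=> [/sub //|/andP[/sub ux /sub yv]|/andP[/sub uy /sub xv]].
    exact: connect_trans ux (connect_trans xy yv).
  rewrite connect_adj_sym in xy.
  exact: connect_trans uy (connect_trans xy xv).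
Qed.

Lemma acyclicS F F' : F \subset F' -> acyclic F' -> acyclic F.
Proof.
move=> sF /acyclicP acF; apply/acyclicP=> c c_gt2 Uc.
by apply: contra (acF c c_gt2 Uc); apply: sub_cycle; apply: sub_adj.
Qed.

Lemma cycle_connect_setD1 x y p F :
  0 < size p -> uniq [:: x, y & p] -> cycle (adj F) [:: x, y & p] ->
  connect (adj (F :\ [set x; y])) x y.
Proof.
case: p => // w q _; rewrite !cons_uniq !inE !negb_or.
case/and4P=> /and3P[neq_xy neq_xw _] /andP[neq_yw yq] _ _ /= /and3P[_ yw wq].
rewrite connect_adj_sym; apply/connectP.
exists (w :: rcons q x); last by rewrite /= last_rcons.
rewrite /= adj_setD1 yw andbT; apply/andP; split.
  apply/eqP=> /eq_set2[[yx _]|[_ wx]]; first by rewrite yx eqxx in neq_xy.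
  by rewrite wx eqxx in neq_xw.
apply: (sub_in_path (P := predC1 y) _ _ wq) => [a b|].
  rewrite !inE adj_setD1 => neq_ay neq_by ->; rewrite andbT.
  by apply/eqP=> /eq_set2[[_ yE]|[yE _]]; rewrite yE eqxx in neq_ay neq_by.
rewrite /= all_rcons /= eq_sym neq_yw neq_xy.
by apply/allP=> a aq /=; apply: contraNneq yq => <-.
Qed.

Lemma acyclic_bridgeP F :
  reflect (forall x y, x != y -> [set x; y] \in F ->
             ~~ connect (adj (F :\ [set x; y])) x y)
          (acyclic F).
Proof.
apply: (iffP (acyclicP F)) => [acF x y neq_xy xyF|bridge].
  apply/negP=> /connectP[p0 Fp0 yE]; case/shortenP: Fp0 yE => p Fp Up _ yE.
  have p_gt1 : 1 < size p.
    case: p Fp yE {Up} => [|w [|w' p]] //= => [_ xE|/andP[+ _] yw].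
      by rewrite xE eqxx in neq_xy.
    by rewrite yw adj_setD1 eqxx.
  case/negP: (acF (x :: p) p_gt1 Up).
  rewrite /= rcons_path (sub_path (sub_adj (subD1set _ _)) Fp) -yE adj_sym.
  exact: xyF.
case=> [|x [|y p]] // p_gt0 Up; apply/negP=> cycp.
have neq_xy : x != y by case/andP: Up; rewrite inE negb_or => /andP[].
have xyF : [set x; y] \in F by case/andP: cycp.
by case/negP: (bridge x y neq_xy xyF); apply: cycle_connect_setD1 cycp.
Qed.

Lemma acyclic_setU1 x y F : x != y -> [set x; y] \notin F ->
  acyclic ([set x; y] |: F) = acyclic F && ~~ connect (adj F) x y.
Proof.
move=> neq_xy xyF; apply/idP/andP=> [acF|[acF nxy]].
  split; first exact: acyclicS (subsetUr _ _) acF.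
  have /acyclic_bridgeP/(_ x y neq_xy (setU11 _ _)) := acF.
  by rewrite setU1K.
apply/acyclic_bridgeP=> u v neq_uv; rewrite in_setU1.
case: eqP => [uvE _|/eqP neq_e /= uvF].
  rewrite uvE setU1K //; case: (eq_set2 uvE) => -[-> ->] //.
  by rewrite connect_adj_sym.
have symF := connect_adj_sym F.
have nuv := acyclic_bridgeP _ acF u v neq_uv uvF.
have sub := @sub_connect_adj _ _ (subD1set F [set u; v]).
have uv : connect (adj F) u v by apply: connect1.
have -> : ([set x; y] |: F) :\ [set u; v] = [set x; y] |: (F :\ [set u; v]).
  apply/setP=> e; rewrite !inE; case: (e =P [set x; y]) => [->|] //=.
  by rewrite eq_sym neq_e.
(* A detour around [uv] must use [xy]; closing it up with [uv] joins [x] to [y]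
   inside [F]. *)
rewrite connect_setU1 (negPf nuv) /=; apply: contra nxy.
case/orP=> [/andP[/sub ux /sub yv]|/andP[/sub uy /sub xv]].
  by rewrite -(same_connect symF ux) (same_connect symF uv) symF.
by rewrite (same_connect symF xv) -(same_connect symF uv).
Qed.

Lemma connectedP V F r : r \in V ->
  reflect {in V, forall v, connect (adj F) v r} (connected V F).
Proof.
move=> rV; apply: (iffP forall_inP) => [cV v vV|cV u uV].
  by have /forall_inP := cV v vV; apply.
apply/forall_inP=> v vV; apply: connect_trans (cV u uV) _.
by rewrite connect_adj_sym cV.
Qed.

(* Spanning forests of [V] with exactly two components, one containing [r] and
   the other [s]; they are the trees through the edge [rs] with it removed. *)
Definition bitree r s V F : bool :=
  [&& acyclic F, ~~ connect (adj F) r s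
    & [forall v in V, connect (adj F) v r || connect (adj F) v s]].

Lemma bitree_notin_edge r s V F : bitree r s V F -> [set r; s] \notin F.
Proof. by case/and3P=> _ rs _; apply: contra rs => /(@connect1 _ (adj F)). Qed.

Lemma bitree_diag r V F : bitree r r V F = false.
Proof. by rewrite /bitree connect0 andbF. Qed.

Lemma tree_setU1 r s V F : r \in V -> r != s -> [set r; s] \notin F ->
  tree V ([set r; s] |: F) = bitree r s V F.
Proof.
move=> rV neq_rs rsF; rewrite /tree acyclic_setU1 // /bitree andbC -andbA.
congr (_ && _); case: (boolP (connect _ r s)) => //= nrs.
apply/(connectedP _ rV)/forall_inP => cV v /cV.
  rewrite connect_setU1 !(connect_adj_sym F s r).
  by case/or3P=> [->|/andP[-> _]|/andP[-> _]]; rewrite ?orbT.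
by rewrite connect_setU1 connect0 andbT => /orP[]->; rewrite ?orbT.
Qed.

Lemma set2_notin r z V E :
  z \notin V -> E \subset powerset V -> [set r; z] \notin E.
Proof.
move=> zV /subsetP subE; apply: contra zV => /subE.
by rewrite inE subUset !sub1set => /andP[].
Qed.

Lemma connect_isolated z v V F :
  F \subset powerset V -> z \notin V -> connect (adj F) z v = (z == v).
Proof.
move=> subF zV; apply/idP/eqP=> [|->]; last exact: connect0.
case/connectP=> -[|w p] //=.
by rewrite adj_sym /adj (negPf (set2_notin w zV subF)).
Qed.

Section NewVertex.

Variables (V : {set T}) (r z : T).
Hypotheses (rV : r \in V) (zV : z \notin V).

Let neq_new v : v \in V -> (z == v) = false.
Proof. by move=> vV; apply: contraNF zV => /eqP->. Qed.

Lemma tree_isolated F : F \subset powerset V -> ~~ tree (z |: V) F.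
Proof.
move=> subF; rewrite negb_and; apply/orP; left.
apply/(connectedP _ (setU1r z rV)).
by move/(_ z (setU11 _ _)); rewrite (connect_isolated _ subF zV) neq_new.
Qed.

Lemma bitree_isolated s F : s \in V -> F \subset powerset V ->
  bitree z s (z |: V) F = tree V F.
Proof.
move=> sV subF; have zE v := connect_isolated v subF zV.
rewrite /bitree /tree zE neq_new //= andbC; congr (_ && _).
apply/forall_inP/(connectedP _ sV) => cV v.
  by move=> vV; have := cV v (setU1r z vV); rewrite connect_adj_sym zE neq_new.
by case/setU1P=> [->|/cV ->]; rewrite ?connect0 ?orbT.
Qed.

Section Pendant.

Variable F : {set {set T}}.
Hypothesis subF : F \subset powerset V.

Lemma connect_pendant u v : u \in V -> v \in V ->
  connect (adj ([set r; z] |: F)) u v = connect (adj F) u v.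
Proof.
move=> uV vV; rewrite connect_setU1 (connect_adj_sym F u z).
by rewrite !(connect_isolated _ subF zV) !neq_new // andbF orbF.
Qed.

Lemma connect_pendant_end u : u \in V ->
  connect (adj ([set r; z] |: F)) u z = connect (adj F) u r.
Proof.
move=> uV; rewrite connect_setU1 connect0 (connect_adj_sym F u z) andbT.
by rewrite !(connect_isolated _ subF zV) neq_new // orbF.
Qed.

Lemma acyclic_pendant : acyclic ([set r; z] |: F) = acyclic F.
Proof.
rewrite acyclic_setU1 ?(set2_notin _ zV) //; last by rewrite eq_sym neq_new.
by rewrite connect_adj_sym (connect_isolated _ subF zV) neq_new // andbT.
Qed.

Lemma tree_pendant : tree (z |: V) ([set r; z] |: F) = tree V F.
Proof.
rewrite /tree acyclic_pendant; congr (_ && _).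
apply/(connectedP _ (setU1r z rV))/(connectedP _ rV) => cV v.
  by move=> vV; rewrite -connect_pendant // cV ?setU1r.
case/setU1P=> [->|vV]; last by rewrite connect_pendant ?cV.
by rewrite connect_adj_sym connect_pendant_end ?connect0.
Qed.

Lemma bitree_pendant s : s \in V ->
  bitree z s (z |: V) ([set r; z] |: F) = bitree r s V F.
Proof.
move=> sV; rewrite /bitree acyclic_pendant.
rewrite connect_adj_sym connect_pendant_end // (connect_adj_sym F s).
congr [&& _, _ & _].
apply/forall_inP/forall_inP=> cV v.
  move=> vV; rewrite -connect_pendant_end // -(connect_pendant vV sV).
  exact/cV/setU1r.
case/setU1P=> [->|vV]; first by rewrite connect0.
by rewrite connect_pendant_end // connect_pendant // cV.
Qed.

End Pendant.

End NewVertex.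

Definition ntrees V E := subset_count E (tree V).
Definition nbitrees r s V E := subset_count E (bitree r s V).

Lemma nbitrees_diag r V E : nbitrees r r V E = 0.
Proof. by apply: subset_count0 => F _; rewrite bitree_diag. Qed.

Lemma ntrees_setU1 r s V E : r \in V -> r != s -> [set r; s] \notin E ->
  ntrees V ([set r; s] |: E) = ntrees V E + nbitrees r s V E.
Proof.
move=> rV neq_rs rsE; rewrite /ntrees subset_count_setU1 //; congr (_ + _).
apply: eq_subset_count => F sF; apply: tree_setU1 => //.
by apply: contra rsE; apply: (subsetP sF).
Qed.

Lemma nbitrees_setU1 r s V E : [set r; s] \notin E ->
  nbitrees r s V ([set r; s] |: E) = nbitrees r s V E.
Proof.
move=> rsE; rewrite /nbitrees subset_count_setU1 //.
rewrite [X in _ + X]subset_count0 ?addn0 // => F _.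
by apply/negP=> /bitree_notin_edge; rewrite setU11.
Qed.

Lemma ntrees_delete r s V E : r \in V -> r != s -> [set r; s] \in E ->
  ntrees V E = ntrees V (E :\ [set r; s]) + nbitrees r s V E.
Proof.
move=> rV neq_rs rsE; rewrite -{1 3}(setD1K rsE).
by rewrite nbitrees_setU1 ?ntrees_setU1 ?setD11.
Qed.

Lemma ntrees_pendant r z V E :
  r \in V -> z \notin V -> E \subset powerset V ->
  ntrees (z |: V) ([set r; z] |: E) = ntrees V E.
Proof.
move=> rV zV subE; rewrite /ntrees subset_count_setU1 ?(set2_notin _ zV) //.
rewrite subset_count0 => [|F sF].
  by apply: eq_subset_count => F sF; apply/tree_pendant/(subset_trans sF).
by apply: (tree_isolated rV) => //; apply: subset_trans subE.
Qed.

Lemma nbitrees_pendant r s z V E :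
  r \in V -> s \in V -> z \notin V -> E \subset powerset V ->
  nbitrees z s (z |: V) ([set r; z] |: E) = ntrees V E + nbitrees r s V E.
Proof.
move=> rV sV zV subE.
rewrite /nbitrees subset_count_setU1 ?(set2_notin _ zV) //.
congr (_ + _); apply: eq_subset_count => F /subset_trans/(_ subE).
  exact: bitree_isolated.
by move=> subF; apply: bitree_pendant.
Qed.

End Forests.

Section Walks.

Variable T : finType.
Implicit Types (x y z r s : T) (p : seq T) (e : {set T}).

Lemma walk_edges_nil x : walk_edges x [::] = set0.
Proof. by apply/setP=> e; rewrite inE; apply/imsetP=> -[]. Qed.

Lemma walk_edges_cons x y p :
  walk_edges x (y :: p) = [set x; y] |: walk_edges y p.
Proof.
apply/setP=> e; rewrite in_setU1; apply/imsetP/orP=> [[d]|].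
  rewrite inE => /orP[/eqP->->|dp ->]; [by left | right].
  exact: imset_f.
case=> [/eqP->|/imsetP[d dp ->]]; [exists (x, y) | exists d] => //.
  by rewrite inE eqxx.
by rewrite inE dp orbT.
Qed.

Lemma walk_edges_rcons x p y :
  walk_edges x (rcons p y) = [set last x p; y] |: walk_edges x p.
Proof.
elim: p x => [|w p IHp] x /=; first by rewrite walk_edges_cons.
by rewrite !walk_edges_cons IHp setUCA.
Qed.

Lemma walk_edges_rev x p y :
  walk_edges x (rcons p y) = walk_edges y (rcons (rev p) x).
Proof.
elim: p x => [|w p IHp] x /=.
  by rewrite !walk_edges_cons !walk_edges_nil (setUC [set x]).
rewrite walk_edges_cons IHp rev_cons (walk_edges_rcons y (rcons _ w)).
by rewrite last_rcons (setUC [set x]).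
Qed.

Lemma walk_edges_vertices x p e :
  e \in walk_edges x p -> e \subset [set y in x :: p].
Proof.
elim: p x => [|w p IHp] x; first by rewrite walk_edges_nil inE.
rewrite walk_edges_cons set_cons in_setU1 => /orP[/eqP->|/IHp sep].
  by rewrite subUset !sub1set setU11 !inE eqxx orbT.
by rewrite (subset_trans sep) ?subsetUr.
Qed.

Lemma walk_edges_notin x y z p :
  y \notin x :: p -> [set y; z] \notin walk_edges x p.
Proof.
apply: contra => /walk_edges_vertices.
by rewrite subUset sub1set inE => /andP[].
Qed.

Lemma card_walk_edges x p e :
  path [rel y z | y != z] x p -> e \in walk_edges x p -> #|e| = 2.
Proof.
elim: p x => [|w p IHp] x /=; first by rewrite walk_edges_nil inE.
case/andP=> neq_xw /IHp cardp; rewrite walk_edges_cons.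
by case/setU1P=> [->|/cardp //]; rewrite cards2 neq_xw.
Qed.

Lemma walk_edges_chord x p : uniq (x :: p) -> 1 < size p ->
  [set last x p; x] \notin walk_edges x p.
Proof.
case: p => [|y [|w q]] //; rewrite cons_uniq => /andP[xp Up] _.
rewrite walk_edges_cons in_setU1 negb_or setUC walk_edges_notin // andbT.
apply/eqP=> /eq_set2[[_ ly]|[xy _]]; last by rewrite xy mem_head in xp.
by move: Up; rewrite cons_uniq -{1}ly /= mem_last.
Qed.

End Walks.

Section Ears.

Variable T : finType.
Implicit Types (x z r s u v : T) (p : seq T).
Implicit Types (V e : {set T}) (E : {set {set T}}).

(* The last two conditions hold automatically when [r != s] and [p] is nonempty;
   for [r = s] they force [p] to have at least two vertices. They are phrased
   through the closing edge so that moving the first vertex of [p] into the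
   graph leaves them unchanged. *)
Definition ear V E r s p : bool :=
  [&& [set r; s] \subset V, uniq p, [disjoint p & V], last r p != s
    & [set last r p; s] \notin E :|: walk_edges r p].

Lemma ear_ends V E r s p : ear V E r s p -> r \in V /\ s \in V.
Proof. by case/and5P; rewrite subUset !sub1set => /andP[]. Qed.

Lemma ear_on_point x p : uniq (x :: p) -> 1 < size p ->
  ear [set x] set0 x x p.
Proof.
move=> Uxp p_gt1; have := Uxp; rewrite cons_uniq => /andP[xp Up].
have dx : [disjoint p & [set x]].
  rewrite disjoint_has; apply/hasPn=> y yp; rewrite inE.
  by apply: contraNneq xp => <-.
rewrite /ear setUid subxx Up dx set0U walk_edges_chord // andbT.
by have := last_notin_disjoint x (ltnW p_gt1) dx; rewrite inE.
Qed.

Lemma ear_on_edge V E r s p :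
  r \in V -> s \in V -> E \subset powerset V -> r != s ->
  0 < size p -> uniq p -> [disjoint p & V] -> ear V E r s p.
Proof.
move=> rV sV subE neq_rs p_gt0 Up dV; have lV := last_notin_disjoint r p_gt0 dV.
have sp : s \notin r :: p.
  by rewrite inE negb_or eq_sym neq_rs (disjointFl dV sV).
rewrite /ear subUset !sub1set rV sV Up dV in_setU negb_or.
rewrite (setUC [set last r p]) (set2_notin _ lV subE).
rewrite walk_edges_notin //= andbT.
by apply: contraNneq lV => ->.
Qed.

Lemma setU_cons V z p : V :|: [set y in z :: p] = (z |: V) :|: [set y in p].
Proof. by rewrite set_cons setUCA setUA. Qed.

Lemma setU_walk_cons E r z p :
  E :|: walk_edges r (z :: p) = ([set r; z] |: E) :|: walk_edges z p.
Proof. by rewrite walk_edges_cons setUCA setUA. Qed.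

Lemma powerset_pendant V E r z : r \in V -> E \subset powerset V ->
  [set r; z] |: E \subset powerset (z |: V).
Proof.
move=> rV subE; rewrite subUset sub1set inE subUset !sub1set setU11 setU1r //=.
by rewrite (subset_trans subE) // powersetS subsetUr.
Qed.

Lemma ear_cons V E r s z p : ear V E r s (z :: p) ->
  z \notin V /\ ear (z |: V) ([set r; z] |: E) z s p.
Proof.
case/and5P; rewrite subUset sub1set => /andP[_ sV] Up dV last_neq closing.
have [zV Up' dV'] := uniq_disjoint_cons Up dV; split=> //; apply/and5P.
by rewrite -setU_walk_cons subUset sub1set setU11 (subset_trans sV) ?subsetUr.
Qed.

Lemma ear_first_edge_fresh V E r s z p :
  E \subset powerset V -> ear V E r s (z :: p) ->
  [set r; z] \notin E :|: walk_edges z (rcons p s).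
Proof.
move=> subE earp; have [rV _] := ear_ends earp; have [zV _] := ear_cons earp.
case/and5P: earp => _ _ dV _.
rewrite walk_edges_cons !in_setU !negb_or inE => /and3P[_ neq_closing _].
rewrite (set2_notin _ zV subE) walk_edges_rcons in_setU1 negb_or eq_sym.
by rewrite neq_closing walk_edges_notin // (disjointFl dV rV).
Qed.

Lemma ntrees_pendant_path V E r p :
  r \in V -> E \subset powerset V -> uniq p -> [disjoint p & V] ->
  ntrees (V :|: [set y in p]) (E :|: walk_edges r p) = ntrees V E.
Proof.
elim: p V E r => [|z p IHp] V E r rV subE Up dV.
  by rewrite walk_edges_nil set_nil !setU0.
have [zV Up' dV'] := uniq_disjoint_cons Up dV.
rewrite setU_cons setU_walk_cons IHp ?ntrees_pendant ?setU11 //.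
exact: powerset_pendant.
Qed.

Lemma nbitrees_pendant_path V E r s p :
  r \in V -> s \in V -> E \subset powerset V -> uniq p -> [disjoint p & V] ->
  nbitrees (last r p) s (V :|: [set y in p]) (E :|: walk_edges r p)
  = size p * ntrees V E + nbitrees r s V E.
Proof.
elim: p V E r => [|z p IHp] V E r rV sV subE Up dV.
  by rewrite walk_edges_nil set_nil !setU0.
have [zV Up' dV'] := uniq_disjoint_cons Up dV.
rewrite setU_cons setU_walk_cons /= IHp ?setU11 ?setU1r ?powerset_pendant //.
by rewrite ntrees_pendant // nbitrees_pendant // mulSn addnCA addnA.
Qed.

Lemma ntrees_ear V E r s p :
  E \subset powerset V -> ear V E r s p ->
  ntrees (V :|: [set y in p]) (E :|: walk_edges r (rcons p s))
  = (size p).+1 * ntrees V E + nbitrees r s V E.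
Proof.
move=> subE earp; have [rV sV] := ear_ends earp.
case/and5P: earp => _ Up dV last_neq closing.
rewrite walk_edges_rcons setUCA ntrees_setU1 //; last first.
  by have := mem_last r p; rewrite !inE => /orP[/eqP->|->]; rewrite ?rV ?orbT.
by rewrite ntrees_pendant_path // nbitrees_pendant_path // mulSn addnA.
Qed.

Lemma ntrees_ear_delete V E r s p e :
  E \subset powerset V -> ear V E r s p ->
  e \in walk_edges r (rcons p s) ->
  ntrees (V :|: [set y in p]) ((E :|: walk_edges r (rcons p s)) :\ e)
  = ntrees V E.
Proof.
elim: p V E r => [|z p IHp] V E r subE earp.
  rewrite walk_edges_cons walk_edges_nil set_nil !setU0 => /set1P->.
  case/and5P: earp => _ _ _ _; rewrite walk_edges_nil setU0 /= => rsE.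
  by rewrite setUC setU1K.
have [[rV sV] [zV earp']] := (ear_ends earp, ear_cons earp).
rewrite rcons_cons.
rewrite {1}walk_edges_cons in_setU1 => /orP[/eqP->|ep]; last first.
  by rewrite setU_cons setU_walk_cons IHp ?powerset_pendant // ntrees_pendant.
(* Without its first edge the ear is a pendant path growing from [s]. *)
rewrite walk_edges_cons setUCA setU1K ?(ear_first_edge_fresh subE earp) //.
have /and5P[_ Up dV _ _] := earp; rewrite walk_edges_rev -rev_cons.
have -> : [set y in z :: p] = [set y in rev (z :: p)].
  by apply/setP=> y; rewrite !inE mem_rev.
rewrite ntrees_pendant_path ?rev_uniq //.
by rewrite (eq_disjoint (mem_rev _)).
Qed.

Lemma nbitrees_ear V E r s p u v :
  E \subset powerset V -> ear V E r s p ->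
  [set u; v] \in walk_edges r (rcons p s) ->
  u \in V :|: [set y in p] -> u != v ->
  nbitrees u v (V :|: [set y in p]) (E :|: walk_edges r (rcons p s))
  = size p * ntrees V E + nbitrees r s V E.
Proof.
move=> subE earp uvW uV' neq_uv; apply: (@addnI (ntrees V E)).
rewrite addnA -mulSn -ntrees_ear // -(ntrees_ear_delete subE earp uvW).
by rewrite -ntrees_delete // in_setU uvW orbT.
Qed.

End Ears.

Section SimpleGraphs.

Variable T : finType.
Implicit Types (G : sgraph T) (x r s u v : T) (p : seq T).
Implicit Types (V : {set T}) (E : {set {set T}}).

Lemma edges_sub_powerset G : edges G \subset powerset (vertices G).
Proof. by apply/subsetP=> e /edgesP[]; rewrite inE. Qed.

Lemma edge_ends G r s : [set r; s] \in edges G ->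
  [/\ r \in vertices G, s \in vertices G & r != s].
Proof.
case/edgesP; rewrite subUset !sub1set cards2 => /andP[-> ->].
by case: (r == s).
Qed.

Lemma ear_edgesP V E r s p : ear V E r s p ->
  (forall e, e \in E -> e \subset V /\ #|e| = 2) ->
  forall e, e \in E :|: walk_edges r (rcons p s) ->
  e \subset V :|: [set y in p] /\ #|e| = 2.
Proof.
move=> earp edgesE e; have [rV sV] := ear_ends earp.
case/and5P: earp => _ Up dV neq_last _.
rewrite in_setU => /orP[/edgesE[sub_e ->]|ep].
  by split=> //; apply: subset_trans sub_e (subsetUl _ _).
split.
  apply: subset_trans (walk_edges_vertices ep) _; apply/subsetP=> y.
  rewrite !inE mem_rcons inE.
  by case/or3P=> [/eqP->|/eqP->|->]; rewrite ?rV ?sV ?orbT.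
apply: card_walk_edges ep; rewrite rcons_path /= neq_last andbT.
apply: (@pairwise_sorted _ _ (r :: p)); rewrite -uniq_pairwise /= Up andbT.
by rewrite (disjointFl dV rV).
Qed.

Lemma exists_ear_extension G r s p :
  ear (vertices G) (edges G) r s p ->
  exists G', vertices G' = vertices G :|: [set y in p] /\
             edges G' = edges G :|: walk_edges r (rcons p s).
Proof.
by move=> earp; exists (SGraph (ear_edgesP earp (@edgesP _ G))).
Qed.

Lemma ear_extension_counts G G' r s p :
  ear (vertices G) (edges G) r s p ->
  vertices G' = vertices G :|: [set y in p] ->
  edges G' = edges G :|: walk_edges r (rcons p s) ->
  tau G' = (size p).+1 * tau G + nbitrees r s (vertices G) (edges G) /\
  forall u v, [set u; v] \in walk_edges r (rcons p s) ->
    nbitrees u v (vertices G') (edges G')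
    = size p * tau G + nbitrees r s (vertices G) (edges G).
Proof.
move=> earp VG' EG'; have subE := edges_sub_powerset G.
split=> [|u v uvW]; first by rewrite -(ntrees_ear subE earp) -VG' -EG'.
have uvG' : [set u; v] \in edges G' by rewrite EG' in_setU uvW orbT.
have [uG' _ neq_uv] := edge_ends uvG'.
by rewrite VG' in uG' *; rewrite EG' nbitrees_ear.
Qed.

Lemma point_edgesP x (e : {set T}) :
  e \in set0 -> e \subset [set x] /\ #|e| = 2.
Proof. by rewrite inE. Qed.

Definition point_graph x : sgraph T := SGraph (@point_edgesP x).

Lemma tau_point_graph x : tau (point_graph x) = 1.
Proof.
rewrite /tau -(cards1 (set0 : {set {set T}})).
apply: eq_card => F; rewrite !inE subset0.
case: eqP => //= ->; apply/andP; split.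
  by apply/(connectedP _ (set11 x)) => v /set1P->; apply: connect0.
by apply/acyclic_bridgeP=> u v _; rewrite inE.
Qed.

End SimpleGraphs.

(* The components count the spanning trees of a [(k, n)]-accordion and those
   among them through a given free edge; a single free edge serves as the
   [(k, 0)]-accordion. *)
Definition accordion_counts (k n : nat) : nat * nat :=
  iter n (fun tc => ((k - 1) * tc.1 + tc.2, (k - 2) * tc.1 + tc.2)) (1, 1).

Lemma accordion_counts_avoiding k n : 1 < k ->
  (accordion_counts k n.+1).1
  = (accordion_counts k n).1 + (accordion_counts k n.+1).2.
Proof. by move=> k_gt1; rewrite /= addnA -mulSn subnSK. Qed.

Lemma accordion_counts_rec k n : 1 < k ->
  (accordion_counts k n.+2).1 + (accordion_counts k n).1
  = k * (accordion_counts k n.+1).1.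
Proof.
move=> k_gt1.
have -> : (accordion_counts k n.+2).1
          = (k - 1) * (accordion_counts k n.+1).1 + (accordion_counts k n.+1).2.
  by [].
rewrite -addnA [_.2 + _]addnC -accordion_counts_avoiding // -mulSnr.
by rewrite subn1 prednK // ltnW.
Qed.

Section Accordions.

Variable (T : finType) (k : nat).
Hypothesis k_gt2 : 2 < k.
Implicit Types (G : sgraph T) (fr : {set {set T}}) (x r s : T) (p : seq T).

Lemma accordion_free_sub_edges n G fr :
  accordion_free k n G fr -> fr \subset edges G.
Proof. by case=> // *; apply/subsetP=> e; rewrite inE => /andP[]. Qed.

Lemma accordion_cycle_ear x p :
  uniq (x :: p) -> size (x :: p) = k -> ear [set x] set0 x x p.
Proof.
by move=> Up szp; apply: ear_on_point => //; move: k_gt2; rewrite -szp.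
Qed.

Lemma accordion_free_ear n G fr r s p :
  accordion_free k n G fr -> [set r; s] \in fr ->
  uniq p -> size p = k - 2 -> [disjoint p & vertices G] ->
  ear (vertices G) (edges G) r s p.
Proof.
move=> accG rs_fr Up szp dp.
have rsG := subsetP (accordion_free_sub_edges accG) _ rs_fr.
have [rG sG neq_rs] := edge_ends rsG.
by rewrite ear_on_edge ?edges_sub_powerset // szp subn_gt0.
Qed.

Lemma accordion_free_counts n G fr : accordion_free k n G fr ->
  tau G = (accordion_counts k n).1 /\
  forall r s, [set r; s] \in fr ->
    nbitrees r s (vertices G) (edges G) = (accordion_counts k n).2.
Proof.
elim=> {n G fr} [G x p Up szp VG EG|n G G' fr r s p accG].
  have [||-> nbitreesG] := @ear_extension_counts _ (point_graph x) G x x p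
    (accordion_cycle_ear Up szp).
  - by rewrite VG set_cons.
  - by rewrite EG /= set0U.
  have size_p : size p = k - 1 by rewrite -szp subn1.
  rewrite tau_point_graph nbitrees_diag size_p muln1 addn0 in nbitreesG *.
  split=> [|r s]; first by rewrite /= !muln1 addn0 addn1.
  rewrite EG => /nbitreesG; rewrite -EG => ->.
  by rewrite /= muln1 addn1 subnSK // ltnW.
move=> [tauG nbitreesG] rs_fr Up szp dp VG' EG'.
have earp := accordion_free_ear accG rs_fr Up szp dp.
have [] := ear_extension_counts earp VG' EG'.
rewrite tauG nbitreesG // szp subnSK ?(ltnW k_gt2) // => -> nbitreesG'.
split=> // u v; rewrite inE => /andP[uvE /exists_inP[y yuv yp]].
apply: nbitreesG'.
move: uvE; rewrite EG' in_setU => /orP[/edgesP[/subsetP/(_ y yuv) yG _]|//].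
by rewrite (disjointFr dp yp) in yG.
Qed.

Lemma accordion_free_edge n G fr : accordion_free k n G fr ->
  exists r s, [set r; s] \in fr.
Proof.
case=> {n G fr} [G x p _ _ _ EG|n G G' fr r s p _ _ _ szp _ _ EG'].
  by exists (last x p), x; rewrite EG walk_edges_rcons setU11.
exists (last r p), s; rewrite inE EG' walk_edges_rcons !inE eqxx orbT /=.
apply/exists_inP; exists (last r p); first exact: set21.
have : 0 < size p by rewrite szp subn_gt0.
by case: (p) => //= z q _; apply: mem_last.
Qed.

Lemma card_accordion_vertices n G fr :
  accordion_free k n G fr -> #|vertices G| <= k * n.
Proof.
elim=> {n G fr} [G x p _ <- -> _|n G G' fr r s p _ IH _ _ szp _ -> _].
  by rewrite muln1 cardsE card_size.
rewrite (leq_trans (leq_card_setU _ _)) // mulnSr leq_add //.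
by rewrite cardsE (leq_trans (card_size _)) // szp leq_subr.
Qed.

Lemma accordion_cycle_exists : k <= #|T| ->
  exists G fr, accordion_free k 1 G fr.
Proof.
move=> leT; have [|[|x p] [Up szp _]] := @exists_uniq_disjoint T set0 k.
- by rewrite cards0 addn0.
- by move: k_gt2; rewrite -szp.
have [G [VG EG]] := @exists_ear_extension _ (point_graph x) x x p
  (accordion_cycle_ear Up szp).
exists G, (edges G); apply: AccordionCycle Up szp _ _.
  by rewrite VG set_cons.
by rewrite EG /= set0U.
Qed.

Lemma accordion_exists n : k * n.+1 <= #|T| ->
  exists G fr, accordion_free k n.+1 G fr.
Proof.
elim: n => [|n IHn]; first by rewrite muln1; apply: accordion_cycle_exists.
rewrite mulnS => leT.
have [|G [fr accG]] := IHn; first exact: leq_trans (leq_addl _ _) leT.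
have [r [s rs_fr]] := accordion_free_edge accG.
have [|p [Up szp dp]] := @exists_uniq_disjoint T (vertices G) (k - 2).
  apply: leq_trans leT; rewrite leq_add ?leq_subr //.
  exact: card_accordion_vertices accG.
have earp := accordion_free_ear accG rs_fr Up szp dp.
have [G' [VG' EG']] := exists_ear_extension earp.
by exists G'; eexists; apply: AccordionStep accG rs_fr Up szp dp VG' EG'.
Qed.

End Accordions.

Theorem theorem2 :
  exists tauA : nat -> nat -> nat,
    (forall k n : nat, 3 <= k -> 1 <= n ->
       (exists (T : finType) (G : sgraph T), accordion k n G) /\
       (forall (T : finType) (G : sgraph T),
          accordion k n G -> tau G = tauA k n)) /\
    (forall k n : nat, 3 <= k -> 3 <= n ->
       ((tauA k n)%:Z =
          k%:Z * (tauA k (n - 1)%N)%:Z - (tauA k (n - 2)%N)%:Z)%R).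
Proof.
exists (fun k n => (accordion_counts k n).1); split=> k [|n] // k_ge3.
  move=> _; split=> [|T G [fr accG]].
    have [|G [fr accG]] := @accordion_exists 'I_(k * n.+1) k k_ge3 n.
      by rewrite card_ord.
    by exists 'I_(k * n.+1), G, fr.
  by have [] := accordion_free_counts k_ge3 accG.
case: n => [|n] // _; rewrite !subSS !subn0.
by rewrite -PoszM -(accordion_counts_rec n (ltnW k_ge3)) PoszD GRing.addrK.
Qed.
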